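(* There exists an absolute constant $C>0$ such that for every prime power $q$ and every set $A\subset M_2(\mathbb{F}_q)$ with $|A|\ge C\,q^{15/4}$, we have \[\{a_1a_2+a_3+a_4:\ a_1,a_2,a_3,a_4\in A\}=M_2(\mathbb{F}_q).\]
   Context: $\mathbb{F}_q$ is the finite field with $q$ elements and $M_2(\mathbb{F}_q)$ is the ring of $2\times 2$ matrices over $\mathbb{F}_q$. *)

(* Defs.v *)
From HB Require Import structures.
From mathcomp Require Import all_boot all_order all_algebra.
Set Implicit Arguments.
Unset Strict Implicit.
Unset Printing Implicit Defensive.
Import Order.TTheory GRing.Theory Num.Theory.
Local Open Scope ring_scope.

Definition prod_sum_sum_set (F : finFieldType) (A : {set 'M[F]_2}) :
    {set 'M[F]_2} :=
  [set x | [exists a1 in A, exists a2 in A, exists a3 in A, exists a4 in A,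
              x == a1 *m a2 + a3 + a4]].

(* Main.v *)
(** Let [n] be the cardinality of a finite ring, [s] its number of non-units,
    and [g (u, v)] the number of pairs [(b, c)] in [A^2] with [u b + c = v].
    The mean of [g] is [|A|^2 / n], and its second moment counts the
    [(u, b, c, b', c')] with [u (b - b') = c' - c]: at most one [u] when
    [b - b'] is a unit, and at most [n] pairs [(u, c')] otherwise, so that
    [sum g^2 <= |A|^4 + |A|^2 s n].  If [x] is not of the form
    [a1 a2 + a3 + a4] then [g] vanishes at the [|A|^2] points
    [(a1, x - a3)], which by the variance bound forces [|A|^4 <= n^3 s].
    For 2x2 matrices over a field with [q] elements, [n = q^4] and
    [s <= 2 q^3], so [|A|^4 <= 2 q^15]. *)
Require Import Defs.
From HB Require Import structures.
From mathcomp Require Import all_boot all_order all_algebra.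
From mathcomp Require Import ring zify.
From mathcomp Require Import reals exp.
Set Implicit Arguments.
Unset Strict Implicit.
Unset Printing Implicit Defensive.
Import Order.TTheory GRing.Theory Num.Theory.
Local Open Scope ring_scope.

Section SecondMoment.

Variables (T : finUnitRingType) (A : {set T}).

Definition nonunits : {set T} := [set d | d \isn't a GRing.unit].

Definition line_count (u v : T) : nat :=
  (\sum_(b in A) \sum_(c in A) (u * b + c == v)%R)%N.

(** For fixed [u], each pair [(b, c)] is counted at the single value [v = u * b + c]. *)
Lemma sum_line_count :
  (\sum_u \sum_v line_count u v = #|T| * #|A| ^ 2)%N.
Proof.
rewrite (eq_bigr (fun=> #|A| ^ 2)%N) ?sum_nat_const // => u _.
rewrite /line_count exchange_big /= expnS expn1 -sum_nat_const.
apply: eq_bigr => b _; rewrite exchange_big /= -sum1_card.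
apply: eq_bigr => c _; rewrite (bigD1 (u * b + c)) //= eqxx big1 // => v.
by rewrite eq_sym => /negPf->.
Qed.

Lemma sum_line_count_sqr :
  (\sum_u \sum_v line_count u v ^ 2 =
   \sum_(b in A) \sum_(b' in A) \sum_(c in A) \sum_(c' in A)
     \sum_u (u * (b - b') + c == c')%R)%N.
Proof.
have sqrE u : (\sum_v line_count u v ^ 2 =
  \sum_(b in A) \sum_(b' in A) \sum_(c in A) \sum_(c' in A)
     (u * (b - b') + c == c')%R)%N.
  under eq_bigr => v _.
    rewrite expnS expn1 /line_count big_distrl /=.
    under eq_bigr => b _.
      rewrite big_distrr /=; under eq_bigr => b' _.
        rewrite big_distrl /=; under eq_bigr do rewrite big_distrr /=.
        over.
      over.
    over.
  rewrite exchange_big; apply: eq_bigr => b _.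
  rewrite exchange_big; apply: eq_bigr => b' _.
  rewrite exchange_big; apply: eq_bigr => c _.
  rewrite exchange_big; apply: eq_bigr => c' _.
  (* Only [v = u * b + c] survives, and the second equation becomes [u * b' + c' = u * b + c]. *)
  rewrite (bigD1 (u * b + c)) //= eqxx mul1n big1 => [|v].
    by rewrite addn0 mulrBr addrAC subr_eq eq_sym [c' + _]addrC.
  by rewrite eq_sym => /negPf->.
under eq_bigr => u _ do rewrite sqrE.
rewrite exchange_big; apply: eq_bigr => b _.
rewrite exchange_big; apply: eq_bigr => b' _.
rewrite exchange_big; apply: eq_bigr => c _.
by rewrite exchange_big.
Qed.

Lemma sum_affine_solutions_le (d c : T) :
  (\sum_(c' in A) \sum_u (u * d + c == c')%R <=
   #|A| + (d \in nonunits) * #|T|)%N.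
Proof.
rewrite inE; case: (boolP (d \is a GRing.unit)) => [du|_] /=.
  rewrite mul0n addn0 -sum1_card; apply: leq_sum => c' _.
  rewrite (bigD1 ((c' - c) / d)) //= big1 ?addn0 ?leq_b1 // => u.
  apply: contraNeq; rewrite eqb0 negbK => /eqP <-.
  by rewrite addrK mulrK.
(* For a non-unit [d], summing over [u] outermost helps: each [u] determines at most one [c']. *)
rewrite mul1n exchange_big /= (leq_trans _ (leq_addl _ _)) // -sum1_card.
apply: leq_sum => u _; rewrite -big_mkcondr /= sum1_card.
by rewrite (leq_trans _ (eq_leq (card1 (u * d + c)))) //;
   apply: subset_leq_card; apply/subsetP => y; rewrite !inE eq_sym => /andP[].
Qed.

Lemma sum_line_count_sqr_le :
  (\sum_u \sum_v line_count u v ^ 2 <=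
   #|A| ^ 4 + #|A| ^ 2 * #|nonunits| * #|T|)%N.
Proof.
rewrite sum_line_count_sqr.
have lineP b : (\sum_(b' in A) \sum_(c in A) \sum_(c' in A)
    \sum_u (u * (b - b') + c == c')%R <=
  #|A| ^ 3 + #|A| * #|nonunits| * #|T|)%N.
  apply: (@leq_trans (\sum_(b' in A)
    (#|A| ^ 2 + #|A| * ((b - b')%R \in nonunits) * #|T|))).
    apply: leq_sum => b' _.
    rewrite expnS expn1 -mulnA -mulnDr -sum_nat_const; apply: leq_sum => c _.
    exact: sum_affine_solutions_le.
  rewrite big_split /= sum_nat_const -expnS leq_add2l -big_distrl /=.
  rewrite -big_distrr /= leq_mul2r leq_mul2l.
  (* Distinct [b'] give distinct differences [b - b'], so at most [#|nonunits|] of them are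
     non-units. *)
  suff -> : (\sum_(b' in A) ((b - b')%R \in nonunits) <= #|nonunits|)%N.
    by rewrite !orbT.
  rewrite -big_mkcondr sum1_card /=.
  have subI : injective (fun b' => b - b') by move=> y z /addrI/oppr_inj.
  rewrite -(card_imset _ subI); apply/subset_leq_card/subsetP.
  by move=> _ /imsetP[b' /andP[_ ?] ->].
apply: leq_trans (leq_sum _ (fun b _ => lineP b)) _.
rewrite sum_nat_const; move: #|A| #|nonunits| #|T| => a s n.
by rewrite mulnDr -expnS !mulnA.
Qed.

Lemma card_le_of_missed_point (x : T) :
  (forall a1 a2 a3 a4, a1 \in A -> a2 \in A -> a3 \in A -> a4 \in A ->
     x != a1 * a2 + a3 + a4) ->
  (#|A| ^ 4 <= #|T| ^ 3 * #|nonunits|)%N.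
Proof.
move=> xP; have [A0|A_gt0] := posnP #|A|; first by rewrite A0.
set a := #|A|; set n := #|T|; set s := #|nonunits|.
(* The squared deviation of [line_count] from its mean [a ^ 2 / n], scaled by [n ^ 2] to stay in the
   integers. *)
pose D u v : int := (n%:Z * (line_count u v)%:Z - (a ^ 2)%:Z) ^+ 2.
have lower : ((a ^ 2 * a ^ 4)%:Z <= \sum_u \sum_v D u v).
  (* A solution of [u * b + c' = x - c] would write [x] as [u * b + c' + c], so the count here is
     zero. *)
  have vanish u c : u \in A -> c \in A -> D u (x - c) = (a ^ 4)%:Z.
    move=> uA cA; rewrite /D /line_count big1 => [|b bA].
      by rewrite mulr0 sub0r sqrrN -!natz -natrX -expnM.
    rewrite big1 // => c' c'A; apply/eqP; rewrite eqb0 eq_sym subr_eq.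
    by rewrite addrAC; apply: xP.
  have -> : (a ^ 2 * a ^ 4)%:Z = \sum_(u in A) \sum_(c in A) D u (x - c).
    rewrite (eq_bigr (fun=> (a ^ 4)%:Z *+ a)) => [|u uA].
      by rewrite sumr_const -!natz -!mulrnA -/a; congr (_%:R); lia.
    by rewrite (eq_bigr (fun=> (a ^ 4)%:Z)) ?sumr_const // => c; exact: vanish.
  (* The terms with [u] or [c = x - v] outside [A] are squares and may be dropped. *)
  rewrite [leRHS](bigID [in A]) /= -[leLHS]addr0 lerD ?sumr_ge0 //.
    apply: ler_sum => u _.
    rewrite [leRHS](reindex_inj (can_inj (subKr x))) /=.
    rewrite [leRHS](bigID [in A]) /= lerDl sumr_ge0 // => c _.
    exact: sqr_ge0.
  by move=> u _; apply: sumr_ge0 => v _; exact: sqr_ge0.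
have expand : \sum_u \sum_v D u v =
    n%:Z ^+ 2 * ((\sum_u \sum_v line_count u v ^ 2)%N%:Z - (a ^ 4)%:Z).
  pose m2 : int := n%:Z ^+ 2; pose m1 : int := - 2 * n%:Z * (a ^ 2)%:Z.
  transitivity (m2 * (\sum_u \sum_v line_count u v ^ 2)%N%:Z +
      m1 * (\sum_u \sum_v line_count u v)%N%:Z + (a ^ 4)%:Z *+ n *+ n).
    rewrite -!natz !natr_sum !mulr_sumr -sumr_const -!big_split /=.
    apply: eq_bigr => u _; rewrite !natr_sum !mulr_sumr -sumr_const.
    rewrite -!big_split /=; apply: eq_bigr => v _.
    by rewrite /D /m1 /m2 -!natz !natrX; ring.
  (* The cross term gives [- 2 * n ^ 2 * a ^ 4] and the constant term [n ^ 2 * a ^ 4]. *)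
  by rewrite sum_line_count -/n -/a /m1 /m2; lia.
have upper := sum_line_count_sqr_le.
rewrite -/a -/n -/s in upper.
(* The [a ^ 4] subtracted in [expand] cancels the leading term of [upper]; a factor [a ^ 2],
   positive as [A] is nonempty, is then removed. *)
have : (a ^ 2 * a ^ 4 <= a ^ 2 * (n ^ 3 * s))%N.
  rewrite -lez_nat; apply: le_trans lower _; rewrite expand.
  have -> : (a ^ 2 * (n ^ 3 * s))%N%:Z =
     n%:Z ^+ 2 * (a ^ 2 * s * n)%N%:Z by lia.
  by rewrite ler_wpM2l ?sqr_ge0 // lerBlDl -PoszD lez_nat.
by rewrite leq_pmul2l // expn_gt0 A_gt0.
Qed.

End SecondMoment.

(** With [q = #|F|], the order [q (q - 1)^2 (q + 1)] of [GL_2] leaves exactly [q^3 + q^2 - q]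
    singular matrices. *)
Lemma card_nonunits_mx2_le (F : finFieldType) :
  (#|nonunits 'M[F]_2| <= 2 * #|F| ^ 3)%N.
Proof.
have cardU : #|[set d : 'M[F]_2 | d \is a GRing.unit]| =
    (#|F| * #|F|.-1 ^ 2 * #|F|.+1)%N.
  by rewrite -card_GL_2 cardsE cardsT card_sub.
have q_gt0 : (0 < #|F|)%N by apply/card_gt0P; exists 0.
have -> : nonunits 'M[F]_2 = ~: [set d | d \is a GRing.unit].
  by apply/setP => d; rewrite !inE.
rewrite cardsCs setCK cardU card_mx /=.
by case: #|F| q_gt0 => // m _ /=; lia.
Qed.

Theorem theorem1p14 (R : realType) :
  exists C : R, 0 < C /\
    forall (F : finFieldType) (A : {set 'M[F]_2}),
      C * (#|F|%:R `^ (15%:R / 4%:R)) <= #|A|%:R ->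
      prod_sum_sum_set A = [set: 'M[F]_2].
Proof.
(* Any [C] with [C ^ 4 > 2] contradicts [#|A| ^ 4 <= 2 * #|F| ^ 15]; here [2 ^ 4 = 16]. *)
exists 2; split=> // F A leA; apply/setP => x; rewrite in_setT; apply/negPn/negP.
move=> xN; have q_gt0 : (0 < #|F|)%N by apply/card_gt0P; exists 0.
have missed : (#|A| ^ 4 <= #|{: 'M[F]_2}| ^ 3 * #|nonunits 'M[F]_2|)%N.
  apply: (card_le_of_missed_point (x := x)) => a1 a2 a3 a4 A1 A2 A3 A4.
  apply: contra xN => /eqP xE; rewrite inE.
  apply/exists_inP; exists a1 => //; apply/exists_inP; exists a2 => //.
  by apply/exists_inP; exists a3 => //; apply/exists_inP; exists a4 => //; apply/eqP.
have upper : (#|A| ^ 4 <= 2 * #|F| ^ 15)%N.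
  apply: leq_trans missed _.
  apply: leq_trans (leq_mul (leqnn _) (card_nonunits_mx2_le F)) _.
  by rewrite card_mx -expnM mulnCA -expnD.
have lower : (16 * #|F| ^ 15 <= #|A| ^ 4)%N.
  rewrite -(ler_nat R) natrM !natrX.
  (* The fourth power turns the real exponent [15 / 4] into the natural exponent 15. *)
  have -> : 16%:R * #|F|%:R ^+ 15 =
      (2 * (#|F|%:R `^ (15%:R / 4%:R))) ^+ 4 :> R.
    rewrite exprMn -[X in _ = _ * X]powR_mulrn ?powR_ge0 //.
    rewrite -powRrM divfK ?pnatr_eq0 //.
    by rewrite powR_mulrn ?ler0n // -(natrX _ 2 4).
  by apply: lerXn2r; rewrite ?nnegrE ?mulr_ge0 ?powR_ge0.
have := leq_trans lower upper.
by rewrite leq_pmul2r // expn_gt0 q_gt0.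
Qed.
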